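(* A quasi-countable, $E$-unitary, special inverse monoid has uniformly bounded group distortion if and only if it is $F$-inverse.
   Context: An inverse semigroup is a semigroup $S$ in which every $s$ has a unique $s^{-1}$ with $ss^{-1}s=s$ and $s^{-1}ss^{-1}=s^{-1}$; an inverse monoid is an inverse semigroup with identity. $E(S)$ is its set of idempotents. The natural partial order is $s\le t$ iff $s=te$ for some $e\in E(S)$. Elements $s,t$ are $\mathcal{R}$-related iff $ss^{-1}=tt^{-1}$. $S$ is quasi-countable if there is a countable set $X$ of elements such that $S$ is generated (as an inverse monoid) by $X\cup E(S)$. The maximal group image is $G=S/\sigma$, where $\sigma$ is the least congruence identifying all idempotents; $\sigma\colon S\to G$ also denotes the natural homomorphism. $S$ is $E$-unitary if $\sigma$ is injective on each $\mathcal{R}$-class. $S$ is $F$-inverse if every $\sigma$-class has a maximum element in the natural partial order. An inverse monoid is special if it has an inverse monoid presentation $\mathrm{Inv}\langle X\mid w_i=1\ (i\in I)\rangle$ in which all relations have the form $w_i=1$ with $w_i\in(X\cup X^{-1})^*$; here $\mathrm{Inv}\langle X\mid R\rangle$ is the quotient of the free inverse monoid on $X$ by the congruence generated by $R$. A standard metric on a quasi-countable inverse semigroup $S$ is an extended metric $d\colon S\times S\to[0,\infty]$ which is uniformly discrete (positive lower bound on distances between distinct points), has $d(s,t)<\infty$ iff $s,t$ are $\mathcal{R}$-related, is left subinvariant ($d(xs,xt)\le d(s,t)$ for all $s,t,x$) and proper (for every $r\ge0$ there is a finite $F\subseteq S$ with $y\in xF$ whenever $x\neq y$ and $d(x,y)\le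 r$). Every quasi-countable inverse semigroup (in particular every countable group) has a standard metric, unique up to coarse equivalence. With standard metrics $d_S$ on $S$ and $d_G$ on $G$, $S$ has uniformly bounded group distortion if there is a function $\phi\colon[0,\infty)\to[0,\infty)$ such that $d_S(s,t)\le\phi(d_G(\sigma(s),\sigma(t)))$ for every $\mathcal{R}$-class $R$ of $S$ and all $s,t\in R$. (This does not depend on the choice of standard metrics.) *)

(* Defs.v *)
From HB Require Import structures.
From mathcomp Require Import all_boot order ssralg ssrnum.
From mathcomp Require Import boolp classical_sets cardinality.
From mathcomp Require Import reals constructive_ereal.

Set Implicit Arguments.
Unset Strict Implicit.
Unset Printing Implicit Defensive.

Local Open Scope group_scope.
Local Open Scope quotient_scope.

(* The carrier of a library monoid is a choiceType; since boolp equips every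
   type with a choice structure, this is no restriction. *)

HB.mixin Record StarMonoid_isInverseMonoid S of StarMonoid S := {
  mulsVs : forall s : S, s * s^-1 * s = s;
  mulVsV : forall s : S, s^-1 * s * s^-1 = s^-1;
  inv_unique : forall s t : S, s * t * s = s -> t * s * t = t -> t = s^-1
}.

#[short(type="inverseMonoidType")]
HB.structure Definition InverseMonoid :=
  { S of StarMonoid_isInverseMonoid S & StarMonoid S }.

Bind Scope group_scope with InverseMonoid.sort.

Definition idempotent (S : magmaType) (e : S) : Prop := e * e = e.

(* The star-monoid axioms are no extra assumption: they follow from the
   existence and uniqueness of inverses. *)
HB.factory Record Monoid_isInverseMonoid S of Monoid S & BaseGroup S := {
  mulsVs : forall s : S, s * s^-1 * s = s;
  mulVsV : forall s : S, s^-1 * s * s^-1 = s^-1;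
  inv_unique : forall s t : S, s * t * s = s -> t * s * t = t -> t = s^-1
}.

HB.builders Context S of Monoid_isInverseMonoid S.

Fact idemV (e : S) : idempotent e -> e^-1 = e.
Proof. by move=> ee; apply/esym/inv_unique; rewrite !ee. Qed.

Fact idemM (e f : S) : idempotent e -> idempotent f -> idempotent (e * f).
Proof.
move=> ee ff; set x := (e * f)^-1.
have efx : e * f * x * (e * f) = e * f by apply: mulsVs.
have xef : x * (e * f) * x = x by apply: mulVsV.
have eqx : f * x * e = x.
  apply: inv_unique; rewrite !mulgA.
    rewrite -(mulgA e f f) ff -(mulgA _ e e) ee.
    by move: efx; rewrite !mulgA.
  rewrite -(mulgA (f * x) e e) ee -(mulgA _ f f) ff.
  by move: (congr1 (fun y => f * y * e) xef) => /=; rewrite !mulgA.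
have xx : idempotent x.
  rewrite /idempotent -[X in X * _]eqx -[X in _ * X]eqx !mulgA.
  by move: (congr1 (fun y => f * y * e) xef) => /=; rewrite !mulgA => ->.
have xV : x^-1 = e * f by apply/esym/inv_unique.
by rewrite -xV (idemV xx).
Qed.

Fact idemC (e f : S) : idempotent e -> idempotent f -> e * f = f * e.
Proof.
move=> ee ff; have efef := idemM ee ff; have fefe := idemM ff ee.
rewrite -[LHS]idemV//; apply/esym/inv_unique; rewrite !mulgA.
  rewrite -(mulgA e f f) ff -(mulgA _ e e) ee.
  by move: efef; rewrite /idempotent !mulgA.
rewrite -(mulgA f e e) ee -(mulgA _ f f) ff.
by move: fefe; rewrite /idempotent !mulgA.
Qed.

Fact invgK : involutive (@monoid.inv S).
Proof. by move=> s; apply/esym/inv_unique; [apply: mulVsV|apply: mulsVs]. Qed.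

Fact invgM : {morph @monoid.inv S : s t / s * t >-> t * s}.
Proof.
have id1 (u : S) : idempotent (u * u^-1) by rewrite /idempotent mulgA mulsVs.
have id2 (u : S) : idempotent (u^-1 * u) by rewrite /idempotent mulgA mulVsV.
move=> s t; apply/esym/inv_unique => /=; rewrite !mulgA.
  rewrite -(mulgA s t) -(mulgA _ s^-1 s) -(mulgA s (t / t)) (idemC (id1 t) (id2 s)).
  by rewrite !mulgA mulsVs -!mulgA (mulgA t) mulsVs.
rewrite -(mulgA t^-1 s^-1) -(mulgA _ t t^-1) -(mulgA t^-1 (s^-1 * s)).
rewrite (idemC (id2 s) (id1 t)).
by rewrite !mulgA mulVsV -!mulgA (mulgA s^-1) mulVsV.
Qed.

HB.instance Definition _ := Monoid_isStarMonoid.Build S invgK invgM.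
HB.instance Definition _ :=
  StarMonoid_isInverseMonoid.Build S mulsVs mulVsV inv_unique.

HB.end.

(* A regular monoid with commuting idempotents is an inverse monoid. *)
HB.factory Record Monoid_isRegularCommIdem S of Monoid S & BaseGroup S := {
  mulsVs : forall s : S, s * s^-1 * s = s;
  mulVsV : forall s : S, s^-1 * s * s^-1 = s^-1;
  idemC : forall e f : S, idempotent e -> idempotent f -> e * f = f * e
}.

HB.builders Context S of Monoid_isRegularCommIdem S.

Fact inv_unique (s t : S) : s * t * s = s -> t * s * t = t -> t = s^-1.
Proof.
move=> sts tst.
have i1 : idempotent (s * t) by rewrite /idempotent mulgA sts.
have i2 : idempotent (t * s) by rewrite /idempotent mulgA tst.
have i3 : idempotent (s * s^-1) by rewrite /idempotent mulgA mulsVs.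
have i4 : idempotent (s^-1 * s) by rewrite /idempotent mulgA mulVsV.
have e1 : s * t = s * s^-1.
  by rewrite -[in LHS](mulsVs s) -mulgA (idemC i3 i1) mulgA sts.
have e2 : t * s = s^-1 * s.
  transitivity (t * s * (s^-1 * s)).
    by rewrite -mulgA [s * (_ * _)]mulgA mulsVs.
  by rewrite (idemC i2 i4) -mulgA [s * (_ * _)]mulgA sts.
by rewrite -tst e2 -mulgA e1 mulgA mulVsV.
Qed.

HB.instance Definition _ :=
  Monoid_isInverseMonoid.Build S mulsVs mulVsV inv_unique.

HB.end.

Section InverseMonoidTheory.
Variable S : inverseMonoidType.
Implicit Types s e f : S.

Lemma idem_range s : idempotent (s * s^-1).
Proof. by rewrite /idempotent mulgA mulsVs. Qed.

Lemma idemV e : idempotent e -> e^-1 = e.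
Proof. by move=> ee; apply/esym/inv_unique; rewrite !ee. Qed.

Lemma idemC e f : idempotent e -> idempotent f -> e * f = f * e.
Proof.
move=> ee ff; have eV := idemV ee; have fV := idemV ff.
suff ef : idempotent (e * f) by rewrite -(idemV ef) invgM eV fV.
have efV : (e * f)^-1 = f * e by rewrite invgM eV fV.
have := mulsVs (e * f); rewrite efV /idempotent !mulgA.
by rewrite -(mulgA e f f) ff -(mulgA _ e e) ee.
Qed.

End InverseMonoidTheory.

Section CongruenceQuotient.
Variable M : monoidType.
Implicit Types R C : M -> M -> Prop.

Definition congruence C : Prop :=
  [/\ forall x, C x x,
      forall x y, C x y -> C y x,
      forall x y z, C x y -> C y z -> C x z &
      forall x x' y y', C x x' -> C y y' -> C (x * y) (x' * y')].

Definition cong_gen R x y : Prop :=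
  forall C, congruence C -> (forall u v, R u v -> C u v) -> C x y.

Lemma cong_genP R : congruence (cong_gen R).
Proof.
split=> [x|x y xy|x y z xy yz|x x' y y' xx yy] C cC RC; case: (cC) => r s t m.
- exact: r.
- exact/s/(xy C cC RC).
- exact: t (xy C cC RC) (yz C cC RC).
- exact: m (xx C cC RC) (yy C cC RC).
Qed.

Lemma cong_gen_incl R x y : R x y -> cong_gen R x y.
Proof. by move=> Rxy C _; apply. Qed.

Definition cong_rel R : rel M := fun x y => `[< cong_gen R x y >].

Lemma cong_rel_equiv R : equiv_class_of (cong_rel R).
Proof.
have [r s t _] := cong_genP R; split.
- by move=> x; apply/asboolP; apply: r.
- by move=> x y; apply: asbool_equiv_eq; split=> xy; apply: s.
- by move=> y x z /asboolP xy /asboolP yz; apply/asboolP; exact: t xy yz.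
Qed.

Canonical cong_rel_equiv_rel R := EquivRelPack (cong_rel_equiv R).

Definition mquot R : Type := {eq_quot (cong_rel R)}.

HB.instance Definition _ R := Choice.on (mquot R).
HB.instance Definition _ R := Quotient.on (mquot R).

Section Ops.
Variable R : M -> M -> Prop.
Local Notation Q := (mquot R).

Lemma mquotP x y : \pi_Q x = \pi_Q y <-> cong_gen R x y.
Proof.
split=> [/(@eqmodP _ (cong_rel_equiv_rel R)) /asboolP//|xy].
exact/(@eqmodP _ (cong_rel_equiv_rel R))/asboolP.
Qed.

Definition mquot_mul : Q -> Q -> Q := lift_op2 Q (fun x y => x * y).

Fact mquot_mulE x y : mquot_mul (\pi_Q x) (\pi_Q y) = \pi_Q (x * y).
Proof.
rewrite /mquot_mul -lock; apply/mquotP.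
by have [_ _ _ m] := cong_genP R; apply: m; apply/mquotP/reprK.
Qed.

Fact mquot_mulA : associative mquot_mul.
Proof.
move=> p q r; rewrite -(reprK p) -(reprK q) -(reprK r).
by rewrite !mquot_mulE mulgA.
Qed.

Fact mquot_mul1 : left_id (\pi_Q 1) mquot_mul.
Proof. by move=> p; rewrite -(reprK p) mquot_mulE mul1g. Qed.

Fact mquot_mulr1 : right_id (\pi_Q 1) mquot_mul.
Proof. by move=> p; rewrite -(reprK p) mquot_mulE mulg1. Qed.

HB.instance Definition _ := isMonoid.Build Q mquot_mulA mquot_mul1 mquot_mulr1.

Lemma mquot_piM x y : \pi_Q (x * y) = \pi_Q x * \pi_Q y.
Proof. by rewrite -mquot_mulE. Qed.

Lemma mquot_pi1 : \pi_Q 1 = 1 :> Q. Proof. by []. Qed.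

End Ops.
End CongruenceQuotient.

Section InverseQuotient.
Variables (S : inverseMonoidType) (R : S -> S -> Prop).
Local Notation Q := (mquot R).

(* The inverse is read off a representative; it does not depend on it
   (mquot_piV below), inverses in the quotient being unique. *)
Definition mquot_inv : Q -> Q := lift_op1 Q (fun x => x^-1).

HB.instance Definition _ := hasInv.Build Q mquot_inv.

Fact mquot_invE (q : Q) : q^-1 = \pi_Q (repr q)^-1.
Proof. by rewrite -[LHS]/(mquot_inv q) /mquot_inv -lock. Qed.

Fact mquot_mulsVs (q : Q) : q * q^-1 * q = q.
Proof. by rewrite mquot_invE -{1 3 4}(reprK q) -!mquot_piM mulsVs. Qed.

Fact mquot_mulVsV (q : Q) : q^-1 * q * q^-1 = q^-1.
Proof.
by rewrite mquot_invE -{2}(reprK q) -!mquot_piM mulVsV.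
Qed.

Lemma idem_lift (q : Q) : idempotent q -> exists2 e : S, idempotent e & \pi_Q e = q.
Proof.
rewrite -(reprK q); set a := repr q => /esym qq.
pose b := (a * a)^-1; exists (a * b * a).
  rewrite /idempotent -[LHS]/(a * b * a * (a * b * a)).
  have /(congr1 (fun x => a * x * a)) := mulVsV (a * a).
  by rewrite !mulgA.
have E : \pi_Q a = \pi_Q (a * a) by rewrite mquot_piM -qq.
by rewrite 2!mquot_piM E -2!mquot_piM mulsVs.
Qed.

Fact mquot_idemC (p q : Q) : idempotent p -> idempotent q -> p * q = q * p.
Proof.
move=> /idem_lift[e ee <-] /idem_lift[f ff <-].
by rewrite -!mquot_piM (idemC ee ff).
Qed.

HB.instance Definition _ :=
  Monoid_isRegularCommIdem.Build Q mquot_mulsVs mquot_mulVsV mquot_idemC.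

Lemma mquot_piV (s : S) : \pi_Q s^-1 = (\pi_Q s)^-1.
Proof. by apply: inv_unique; rewrite -!mquot_piM ?mulsVs ?mulVsV. Qed.

End InverseQuotient.

(* The letter (x, false) stands for x and (x, true) for x^-1. *)
Definition word (X : Type) : Type := seq (X * bool).

Section Words.
Variable X : choiceType.

HB.instance Definition _ := Choice.on (word X).

Definition word_inv (w : word X) : word X := rev [seq (a.1, ~~ a.2) | a <- w].

Fact word_invK : involutive word_inv.
Proof.
by move=> w; rewrite /word_inv map_rev revK -map_comp map_id_in// => -[x []].
Qed.

Fact word_invM : {morph word_inv : u v / u ++ v >-> v ++ u}.
Proof. by move=> u v; rewrite /word_inv map_cat rev_cat. Qed.

HB.instance Definition _ := isStarMonoid.Build (word X)
  (@catA _) (@cat0s _) word_invK word_invM.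

(* Vagner's presentation of the free inverse monoid. *)
Inductive vagner : word X -> word X -> Prop :=
| vagner_reg u : vagner (u * u^-1 * u) u
| vagner_comm u v : vagner (u * u^-1 * (v * v^-1)) (v * v^-1 * (u * u^-1)).

Lemma vagner_inv u v : cong_gen vagner u v -> cong_gen vagner u^-1 v^-1.
Proof.
have [r s t m] := cong_genP vagner.
move=> /(_ (fun u v => cong_gen vagner u^-1 v^-1)); apply; first split.
- by move=> x; apply: r.
- by move=> x y; apply: s.
- by move=> x y z; apply: t.
- by move=> x x' y y' xx yy; rewrite !invgM; apply: m.
move=> _ _ [x|x y]; apply: cong_gen_incl; rewrite !invgM !invgK.
  by rewrite mulgA -{2}(invgK x); apply: vagner_reg.
exact: vagner_comm.
Qed.

Definition free_inv_monoid : Type := mquot vagner.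
Local Notation FIM := free_inv_monoid.

HB.instance Definition _ := Monoid.on FIM.
HB.instance Definition _ := Quotient.on FIM.

Definition fim_inv : FIM -> FIM := lift_op1 FIM (fun u => u^-1).

HB.instance Definition _ := hasInv.Build FIM fim_inv.

Lemma fim_piM u v : \pi_FIM (u * v) = \pi_FIM u * \pi_FIM v.
Proof. exact: mquot_piM. Qed.

Lemma fim_piV u : \pi_FIM u^-1 = (\pi_FIM u)^-1.
Proof.
rewrite -[RHS]/(fim_inv _) /fim_inv -lock.
apply/mquotP; apply: vagner_inv; apply/mquotP; apply/esym.
exact: (@reprK _ FIM).
Qed.

Fact fim_mulsVs (p : FIM) : p * p^-1 * p = p.
Proof.
rewrite -(reprK p) -fim_piV -!fim_piM.
apply/mquotP; apply: cong_gen_incl; apply: vagner_reg.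
Qed.

Fact fim_mulVsV (p : FIM) : p^-1 * p * p^-1 = p^-1.
Proof.
rewrite -(reprK p) -fim_piV -!fim_piM; set u := repr p.
by rewrite -{2}(invgK u); apply/mquotP; apply: cong_gen_incl; apply: vagner_reg.
Qed.

Fact fim_rangeC (p q : FIM) : p * p^-1 * (q * q^-1) = q * q^-1 * (p * p^-1).
Proof.
rewrite -(reprK p) -(reprK q) -!fim_piV -!fim_piM.
apply/mquotP; apply: cong_gen_incl; apply: vagner_comm.
Qed.

Fact fim_invK (p : FIM) : p^-1^-1 = p.
Proof. by rewrite -(reprK p) -!fim_piV invgK. Qed.

Fact fim_invM (p q : FIM) : (p * q)^-1 = q^-1 * p^-1.
Proof.
by rewrite -(reprK p) -(reprK q) -!(fim_piM, fim_piV) invgM.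
Qed.

Fact fim_idem_range (p : FIM) : idempotent p -> p = p * p^-1.
Proof.
move=> pp; have ppV : p^-1 * p^-1 = p^-1 by rewrite -fim_invM pp.
suff pV : p^-1 = p by rewrite pV pp.
have := fim_rangeC p^-1 p; rewrite fim_invK => C.
transitivity (p^-1 * p * (p * p^-1)).
  by rewrite mulgA -(mulgA p^-1 p p) pp fim_mulVsV.
by rewrite C mulgA -(mulgA p p^-1 p^-1) ppV fim_mulsVs.
Qed.

Fact fim_idemC (p q : FIM) : idempotent p -> idempotent q -> p * q = q * p.
Proof.
by move=> /fim_idem_range-> /fim_idem_range->; apply: fim_rangeC.
Qed.

HB.instance Definition _ :=
  Monoid_isRegularCommIdem.Build FIM fim_mulsVs fim_mulVsV fim_idemC.

(* Inv<X | R>, a relation being a pair of words. *)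
Definition inv_presentation (R : word X -> word X -> Prop) : inverseMonoidType :=
  mquot (fun p q : FIM => exists u v, [/\ R u v, p = \pi_FIM u & q = \pi_FIM v]).

End Words.

Definition isomorphic (S T : inverseMonoidType) : Prop :=
  exists f : S -> T, monoid_morphism f /\ bijective f.

Definition special (S : inverseMonoidType) : Prop :=
  exists (X : choiceType) (I : Type) (w : I -> word X),
    isomorphic S (inv_presentation (fun u v => exists i, u = w i /\ v = 1)).

Section MaximalGroupImage.
Variable S : inverseMonoidType.

Definition max_group_image : Type :=
  mquot (fun e f : S => idempotent e /\ idempotent f).
Local Notation G := max_group_image.

HB.instance Definition _ := InverseMonoid.on G.
HB.instance Definition _ := Quotient.on G.

Definition sigma : S -> G := \pi_G.

Fact max_group_image_mulVs (g : G) : g^-1 * g = 1.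
Proof.
have [s <-] : exists s : S, \pi_G s = g by exists (repr g); apply: reprK.
rewrite -[_^-1](mquot_piV _ s) -[LHS]mquot_piM -[RHS]mquot_pi1.
apply/mquotP; apply: cong_gen_incl; split; last by rewrite /idempotent mulg1.
by rewrite /idempotent mulgA mulVsV.
Qed.

HB.instance Definition _ :=
  StarMonoid_isGroup.Build G max_group_image_mulVs.

End MaximalGroupImage.

Section InverseMonoidProperties.
Variable S : inverseMonoidType.

Definition natural_le (s t : S) : Prop := exists2 e : S, idempotent e & s = t * e.

Definition Rrel (s t : S) : Prop := s * s^-1 = t * t^-1.

Definition inverse_submonoid (A : set S) : Prop :=
  [/\ A 1, forall s t, A s -> A t -> A (s * t) & forall s, A s -> A s^-1].

Definition generates (A : set S) : Prop :=
  forall B : set S, inverse_submonoid B -> (A `<=` B)%classic -> B = [set: S]%classic.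

Definition quasi_countable : Prop :=
  exists2 X : set S, countable X & generates (X `|` [set e | idempotent e])%classic.

Definition E_unitary : Prop :=
  forall s t : S, Rrel s t -> sigma s = sigma t -> s = t.

Definition F_inverse : Prop :=
  forall g : max_group_image S, exists m : S,
    sigma m = g /\ forall s : S, sigma s = g -> natural_le s m.

End InverseMonoidProperties.

Local Open Scope ereal_scope.

Record extended_metric (R : realType) (T : Type) (d : T -> T -> \bar R) : Prop := {
  emetric_ge0 : forall x y, 0 <= d x y;
  emetric_eq0 : forall x y, d x y = 0 <-> x = y;
  emetric_sym : forall x y, d x y = d y x;
  emetric_triangle : forall x y z, d x z <= d x y + d y z
}.

Record standard_metric (R : realType) (S : inverseMonoidType)
    (d : S -> S -> \bar R) : Prop := {
  standard_emetric : extended_metric d;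
  standard_discrete : exists2 delta : R, (0 < delta)%R &
    forall s t, s <> t -> delta%:E <= d s t;
  standard_finite : forall s t, d s t < +oo <-> Rrel s t;
  standard_subinvariant : forall s t x, d (x * s)%g (x * t)%g <= d s t;
  standard_proper : forall r : R, (0 <= r)%R ->
    exists2 F : set S, finite_set F &
      forall x y, x <> y -> d x y <= r%:E -> exists2 f, F f & y = (x * f)%g
}.

(* dG is finite on the group G, so fine loses no information here. *)
Definition uniformly_bounded_group_distortion (R : realType)
    (S : inverseMonoidType) (dS : S -> S -> \bar R)
    (dG : max_group_image S -> max_group_image S -> \bar R) : Prop :=
  exists2 phi : R -> R, (forall r, 0 <= r -> 0 <= phi r)%R &
    forall s t : S, Rrel s t -> dS s t <= (phi (fine (dG (sigma s) (sigma t))))%:E.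

(* Main.v *)
(* Bounded distortion and properness of dS leave finitely many elements above
   each fibre of sigma, so it suffices that two elements s, t with the same
   image have a common upper bound. Such a bound is an element readable in the
   Schuetzenberger graphs of both s and t, that is, a path from 1 to sigma s in
   their intersection, both graphs being embedded in the Cayley graph of G. If
   there were none, glue the two graphs along the component of 1 in that
   intersection: the generators act on the result by partial injections and,
   the presentation being special, every relator acts as the identity. So S
   acts, and t^-1 s moves one copy of sigma s to the other, whereas it is
   idempotent by E-unitarity.

   Conversely, if m is the maximum of the fibre of g = sigma s^-1 sigma t, then
   t = s m for s R t, so dS s t <= dS (m m^-1) m, and properness of dG allows
   finitely many g within a given distance. *)
Require Import Defs.
From mathcomp Require Import all_boot reals constructive_ereal.
From mathcomp Require Import order ssralg ssrnum.
From mathcomp Require Import boolp classical_sets cardinality.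
(* ssrfun's idempotent would otherwise shadow the one of Defs. *)
Require Import Defs.

Set Implicit Arguments.
Unset Strict Implicit.
Unset Printing Implicit Defensive.

Local Open Scope group_scope.
Local Open Scope quotient_scope.

(** * Schuetzenberger graphs, the natural order and [sigma] *)

Section Readable.
Variable S : inverseMonoidType.
Implicit Types a e s t x y : S.

Lemma idem_source s : idempotent (s^-1 * s).
Proof. by have := idem_range s^-1; rewrite invgK. Qed.

Lemma idem1 : idempotent (1 : S).
Proof. by rewrite /idempotent mulg1. Qed.

(** In the Schuetzenberger graph of the R-class of [a], [x] labels a path from [a] to [a * x]. *)
Definition readable a x : Prop := a * x * x^-1 = a.

Lemma readableM a x y : readable a (x * y) <-> readable a x /\ readable (a * x) y.
Proof.
rewrite /readable invgM !mulgA; split=> [H|[Hx ->//]].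
have Hx : a * x * x^-1 = a.
  by rewrite -{1}H -!mulgA (mulgA x^-1) mulVsV !mulgA.
split=> //.
rewrite -{2}H -(mulgA _ x^-1 x) -(mulgA _ y y^-1) -(mulgA _ (y * y^-1)).
by rewrite (idemC (idem_range y) (idem_source x)) !mulgA Hx.
Qed.

Lemma readableV a x : readable a x -> readable (a * x) x^-1.
Proof. by rewrite /readable invgK => ->. Qed.

Lemma readable_Rrel a x : readable a x <-> Rrel (a * x) a.
Proof.
rewrite /readable /Rrel invgM !mulgA; split=> [->//|H].
have := congr1 (fun z => z * a) H; rewrite mulsVs => E.
rewrite -{2}E -(mulgA _ x x^-1) -(mulgA _ a^-1 a) -(mulgA _ (x * x^-1)).
by rewrite (idemC (idem_range x) (idem_source a)) !mulgA mulsVs.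
Qed.

Lemma readable_range s : readable (s * s^-1) s.
Proof. by rewrite /readable mulsVs. Qed.

Lemma Rrel_range s : Rrel (s * s^-1) s.
Proof. by rewrite /Rrel (idemV (idem_range s)); apply: idem_range. Qed.

Lemma readable1 a : readable a 1.
Proof. by rewrite /readable (idemV idem1) !mulg1. Qed.

(** Recasts the order in terms of paths: [t] leads from the idempotent [s * s^-1] to [s]. *)
Lemma natural_leP s t : natural_le s t <-> s = s * s^-1 * t.
Proof.
split=> [[e ee ->]|H].
  rewrite invgM (idemV ee) !mulgA -(mulgA t e e) ee.
  rewrite -(mulgA _ t^-1 t) -(mulgA t e) (idemC ee (idem_source t)).
  by rewrite !mulgA mulsVs.
exists (t^-1 * s * (t^-1 * s)^-1); first exact: idem_range.
rewrite invgM invgK !mulgA -(mulgA _ s s^-1).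
by rewrite (idemC (idem_range t) (idem_range s)) -(mulgA _ (t / t)) mulsVs.
Qed.

Lemma sigmaM s t : sigma (s * t) = sigma s * sigma t.
Proof. exact: mquot_piM. Qed.

Lemma sigmaV s : sigma s^-1 = (sigma s)^-1.
Proof. exact: mquot_piV. Qed.

Lemma sigma_idem e : idempotent e -> sigma e = 1.
Proof.
move=> ee; rewrite -[RHS]mquot_pi1; apply/mquotP; apply: cong_gen_incl; split=> //.
by rewrite /idempotent mulg1.
Qed.

Lemma sigma_surj (g : max_group_image S) : exists s, sigma s = g.
Proof. by exists (repr g); apply: reprK. Qed.

Lemma E_unitary_idem s : E_unitary S -> sigma s = 1 -> idempotent s.
Proof.
move=> unitS s1; suff -> : s = s * s^-1 by apply: idem_range.
apply: unitS; last by rewrite s1 sigma_idem//; apply: idem_range.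
exact/esym/Rrel_range.
Qed.

End Readable.

(** * Words acting by partial injections, and special presentations *)

Section WordAction.
Variables (X : choiceType) (Y : Type) (E : X -> Y -> Y -> Prop) (D : Y -> Prop).
Hypothesis E_fun : forall x y z z', E x y z -> E x y z' -> z = z'.
Hypothesis E_inj : forall x y y' z, E x y z -> E x y' z -> y = y'.
Hypothesis E_dom : forall x y z, E x y z -> D y /\ D z.
Implicit Types (l : X * bool) (u v w : word X).

Definition letter_act l y z : Prop := if l.2 then E l.1 z y else E l.1 y z.

Fixpoint act w y z : Prop :=
  if w is l :: w' then exists2 y', letter_act l y y' & act w' y' z else y = z.

Lemma act_cat u v y z : act (u ++ v) y z <-> exists2 y', act u y y' & act v y' z.
Proof.
elim: u y => [|l u IH] y /=.
  by split=> [?|[_ <-//]]; first by exists y.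
split=> [[y1 yy1 /IH[y2 ? ?]]|[y2 [y1 ? ?] ?]].
  by exists y2 => //; exists y1.
by exists y1 => //; apply/IH; exists y2.
Qed.

Lemma act_inv w y z : act w^-1 y z <-> act w z y.
Proof.
rewrite -[w^-1]/(word_inv w) /word_inv.
elim: w y z => [|[x b] w IH] y z /=; first by split=> ->.
rewrite rev_cons -cats1.
split=> [/act_cat[y1 /IH zy1 [y2 y1y <-]]|[y1 xb zy]].
  by exists y1 => //; case: b y1y.
by apply/act_cat; exists y1; [apply/IH|exists z => //; case: b xb].
Qed.

Lemma act_fun w y z z' : act w y z -> act w y z' -> z = z'.
Proof.
elim: w y => [|[x b] w IH] y /= => [<-//|[y1 yy1 zz] [y2 yy2]].
suff -> : y2 = y1 by apply: IH.
by case: b yy1 yy2 => yy1 yy2; [apply: E_inj yy2 yy1|apply: E_fun yy2 yy1].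
Qed.

Lemma act_injective w y y' z : act w y z -> act w y' z -> y = y'.
Proof. by move=> /act_inv yz /act_inv; apply: act_fun yz. Qed.

Lemma act_dom w y z : D y -> act w y z -> D z.
Proof.
elim: w y => [|[x b] w IH] y Dy /= => [<-//|[y1 yy1]]; apply: IH.
by case: b yy1 => /E_dom[].
Qed.

Lemma act_range u y z : act (u * u^-1) y z <-> y = z /\ exists z', act u y z'.
Proof.
split=> [/act_cat[y' uy /act_inv uz]|[<- [y' uy]]].
  by split; [apply: act_injective uy uz|exists y'].
by apply/act_cat; exists y' => //; apply/act_inv.
Qed.

(** Restricted to [D] because the empty word fixes every point of [Y], whereas a nonempty word acts
    nowhere outside [D]. *)
Definition act_eq u v : Prop := forall y z, D y -> (act u y z <-> act v y z).

Lemma act_eq_congruence : congruence act_eq.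
Proof.
split=> [u y z _|u v uv y z Dy|u v w uv vw y z Dy|u u' v v' uu vv y z Dy].
- by [].
- by split=> /uv; apply.
- by split=> [/(uv _ _ Dy)/vw|/(vw _ _ Dy)/uv]; apply.
- split=> /act_cat[y' yy' y'z]; apply/act_cat; exists y'.
  + exact/uu.
  + by apply/vv => //; apply: act_dom yy'.
  + exact/uu.
  + by apply/vv => //; apply: act_dom yy'.
Qed.

(** [u * u^-1] acts as the identity on the domain of [u], and such partial identities commute. *)
Lemma act_eq_vagner u v : vagner u v -> act_eq u v.
Proof.
case=> [{}u|{}u {}v] y z _.
  split=> [/act_cat[y' /act_range[<- _]//]|yz].
  by apply/act_cat; exists y => //; apply/act_range; split=> //; exists z.
split=> /act_cat[y' /act_range[<- yu] /act_range[<- yv]]; apply/act_cat.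
  by exists y; apply/act_range.
by exists y; apply/act_range.
Qed.

End WordAction.

(** The last clause is the universal property in terms of congruences on words: a partial action of
    [S] need only be checked on the relators. *)
Lemma special_words (S : inverseMonoidType) : special S ->
  exists (X : choiceType) (I : Type) (w : I -> word X) (val : word X -> S),
    [/\ monoid_morphism val,
        forall u, val u^-1 = (val u)^-1,
        forall s, exists u, val u = s,
        forall i, val (w i) = 1 &
        forall C, congruence C -> (forall u v, vagner u v -> C u v) ->
          (forall i, C (w i) 1) -> forall u v, val u = val v -> C u v].
Proof.
move=> [X [I [w [f [[f1 fM] [f' fK f'K]]]]]].
set P := inv_presentation _ in f f1 fM f' fK f'K.
pose FIM := free_inv_monoid X.
pose pr (u : word X) : P := \pi_P (\pi_FIM u).
have prM u v : pr (u * v) = pr u * pr v by rewrite /pr fim_piM mquot_piM.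
have prV u : pr u^-1 = (pr u)^-1 by rewrite /pr fim_piV mquot_piV.
have finj : injective f := can_inj fK.
have f'V p : f' p^-1 = (f' p)^-1.
  by apply: inv_unique; apply: finj; rewrite !fM !f'K ?mulsVs ?mulVsV.
exists X, I, w, (f' \o pr); split=> /=.
- split; first by apply: finj; rewrite /= f'K f1.
  by move=> u v; apply: finj; rewrite /= fM !f'K prM.
- by move=> u; rewrite prV f'V.
- move=> s; exists (repr (repr (f s) : FIM)).
  rewrite /= /pr (@reprK _ FIM); apply: finj; rewrite f'K; exact: (@reprK _ P).
- move=> i; apply: finj; rewrite f'K f1.
  rewrite -[RHS]/(pr 1) /=; apply/mquotP; apply: cong_gen_incl; by exists (w i), 1; split=> //; exists i.
- move=> C cC Cvag Cw u v /(can_inj f'K)/mquotP H.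
  have [r s t m] := cC.
  have lift u1 v1 : \pi_FIM u1 = \pi_FIM v1 -> C u1 v1.
    by move=> /mquotP; apply.
  (* [C] contains Vagner's relations, so it descends to the free inverse monoid and the choice of
     representatives is immaterial. *)
  pose C' (p q : FIM) := C (repr p) (repr q).
  have C'P u1 v1 : C' (\pi_FIM u1) (\pi_FIM v1) <-> C u1 v1.
    have ru : C (repr (\pi_FIM u1)) u1 by apply/lift/reprK.
    have rv : C (repr (\pi_FIM v1)) v1 by apply/lift/reprK.
    split=> uv; first exact: t (s _ _ ru) (t _ _ _ uv rv).
    exact: t ru (t _ _ _ uv (s _ _ rv)).
  apply/C'P; apply: H; first split.
  + by move=> x; apply: r.
  + by move=> x y; apply: s.
  + by move=> x y z; apply: t.
  + move=> x x' y y' xx yy.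
    rewrite -(@reprK _ FIM x) -(@reprK _ FIM x') -(@reprK _ FIM y) -(@reprK _ FIM y').
    by rewrite -!fim_piM; apply/C'P; apply: m.
  + by move=> _ _ [_ [_ [[i [-> ->]] -> ->]]]; apply/C'P.
Qed.

(** * Gluing two Schuetzenberger graphs *)

Section UpperBound.
Variable S : inverseMonoidType.
Hypothesis unitS : E_unitary S.
Variable e : bool -> S.
Hypothesis ee : forall d, idempotent (e d).
Local Notation G := (max_group_image S).
Implicit Types (a u x : S) (h : G) (d : bool).

Definition glued h : Prop := exists2 u, sigma u = h & forall d, readable (e d) u.

(* Vertices are elements of G tagged by the graph they come from; None tags
   the vertices common to both copies. *)
Definition glue d h : G * option bool := (h, if `[< glued h >] then None else Some d).

Definition glued_edge x (y z : G * option bool) : Prop :=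
  exists d a, [/\ Rrel a (e d), readable a x, y = glue d (sigma a) &
                  z = glue d (sigma (a * x))].

Definition glued_vertex (y : G * option bool) : Prop :=
  exists d a, Rrel a (e d) /\ y = glue d (sigma a).

(** By E-unitarity a vertex of either graph is determined by its image in [G]. *)
Lemma Rrel_readable d a u :
  Rrel a (e d) -> readable (e d) u -> sigma u = sigma a -> a = e d * u.
Proof.
move=> aR /readable_Rrel uR ua; apply: unitS; first by rewrite /Rrel aR uR.
by rewrite sigmaM (sigma_idem (ee d)) mul1g ua.
Qed.

(** Appending [x] or [x^-1] to the path from 1 carries it across an edge that both graphs share. *)
Lemma glued_step d a x : Rrel a (e d) -> readable a x ->
  forall d' a', d' != d -> Rrel a' (e d') -> readable a' x ->
  sigma a' = sigma a -> glued (sigma a) <-> glued (sigma (a * x)).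
Proof.
move=> aR ax d' a' dd a'R a'x aa.
have cases (P : bool -> Prop) : P d -> P d' -> forall b, P b.
  by case: d d' dd {aR a'R} => -[] // _ ? ? [].
split=> -[u us ur]; [exists (u * x)|exists (u * x^-1)].
- by rewrite !sigmaM us.
- apply: cases; apply/readableM; split=> //.
    by rewrite -(Rrel_readable aR).
  by rewrite -(Rrel_readable a'R) // aa.
- by rewrite !sigmaM us sigmaM sigmaV mulgK.
- have step b c : Rrel c (e b) -> readable c x -> sigma c = sigma a ->
      readable (e b) (u * x^-1).
    move=> cR cx ca; apply/readableM; split=> //.
    rewrite -(@Rrel_readable b (c * x)) //; first exact: readableV.
      by rewrite /Rrel -cR; apply/readable_Rrel.
    by rewrite us !sigmaM ca.
  by apply: cases; [apply: (step _ a)|apply: (step _ a')].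
Qed.

(** Edges from different copies share an origin only if it is glued; then [glued_step] glues the
    ends as well. *)
Lemma glued_edge_fun x y z z' : glued_edge x y z -> glued_edge x y z' -> z = z'.
Proof.
move=> [d [a [aR ax -> ->]]] [d' [a' [a'R a'x [aa tag] ->]]].
have [dd|dd] := eqVneq d' d.
  by rewrite dd !sigmaM aa.
have C : glued (sigma a).
  by move: tag; rewrite -aa; case: asboolP => // _ [/eqP]; rewrite eq_sym (negPf dd).
have /asboolP Cx : glued (sigma (a * x)).
  by apply/(glued_step aR ax dd a'R a'x).
by rewrite /glue !sigmaM -aa -sigmaM Cx.
Qed.

Lemma glued_edge_inj x y y' z : glued_edge x y z -> glued_edge x y' z -> y = y'.
Proof.
move=> [d [a [aR ax -> ->]]] [d' [a' [a'R a'x -> [axx tag]]]].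
have aa : sigma a' = sigma a.
  by apply: (mulIg (sigma x)); rewrite -!sigmaM.
have [dd|dd] := eqVneq d' d.
  by rewrite dd aa.
have C : glued (sigma (a * x)).
  by move: tag; rewrite -axx; case: asboolP => // _ [/eqP]; rewrite eq_sym (negPf dd).
have /asboolP Cx : glued (sigma a).
  by apply/(glued_step aR ax dd a'R a'x).
by rewrite /glue aa Cx.
Qed.

Lemma glued_edge_vertex x y z : glued_edge x y z -> glued_vertex y /\ glued_vertex z.
Proof.
move=> [d [a [aR ax -> ->]]]; split; exists d; first by exists a.
by exists (a * x); split=> //; rewrite /Rrel -aR; apply/readable_Rrel.
Qed.

Section Words.
Variables (X : choiceType) (val : word X -> S).
Hypothesis valM : monoid_morphism val.
Hypothesis valV : forall w, val w^-1 = (val w)^-1.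

Local Notation gact := (act (fun x : X => glued_edge (val [:: (x, false)]))).

Lemma act_glued d a w : Rrel a (e d) -> readable a (val w) ->
  gact w (glue d (sigma a)) (glue d (sigma (a * val w))).
Proof.
case: valM => val1 valm.
elim: w a => [|[x b] w IH] a aR /=; first by rewrite [val _]val1 mulg1.
have -> : val ((x, b) :: w) = val [:: (x, b)] * val w by rewrite -valm.
move=> /readableM[ax axw]; exists (glue d (sigma (a * val [:: (x, b)]))); last first.
  rewrite mulgA; apply: IH => //.
  by rewrite /Rrel -aR; apply/readable_Rrel.
rewrite /letter_act /=; case: b ax {axw} => ax; last by exists d, a.
have E : val [:: (x, true)] = (val [:: (x, false)])^-1 by rewrite -valV.
(* An inverse letter runs along an edge backwards, so that edge starts at [a * val
   [:: (x, true)]]. *)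
exists d, (a * val [:: (x, true)]); split=> //.
- by rewrite /Rrel -aR; apply/readable_Rrel.
- by have := readableV ax; rewrite E invgK.
- by have := ax; rewrite /readable E invgK => ->.
Qed.

End Words.
End UpperBound.

Lemma special_upper_bound (S : inverseMonoidType) (s t : S) :
  special S -> E_unitary S -> sigma s = sigma t ->
  exists m, [/\ sigma m = sigma s, natural_le s m & natural_le t m].
Proof.
move=> /special_words[X [I [w [val [valM valV valS valw valC]]]]] unitS st.
pose a d := if d then t else s.
pose e d := a d * (a d)^-1.
have ee d : idempotent (e d) := idem_range (a d).
have eR d : Rrel (e d) (e d) by [].
have aR d : Rrel (a d) (e d) by apply/esym/Rrel_range.
(* The path [m] from [e d] must end at [a d], that is, [a d = a d * (a d)^-1 * m]. *)
suff [m ms mr] : glued e (sigma s).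
  have le d : natural_le (a d) m.
    apply/natural_leP/(@Rrel_readable _ unitS e ee d).
    - exact: aR.
    - exact: mr.
    - by rewrite ms /a; case: d.
  by exists m; split; [|apply: (le false)|apply: (le true)].
have C1 : glued e 1 by exists 1; [exact: sigma_idem (@idem1 S)|move=> d; exact: readable1].
pose E x := glued_edge e (val [:: (x, false)]).
have Efun x := @glued_edge_fun _ unitS e ee (val [:: (x, false)]).
have Einj x := @glued_edge_inj _ unitS e ee (val [:: (x, false)]).
have Edom x := @glued_edge_vertex _ e (val [:: (x, false)]).
have actE := act_glued valM valV.
(* Having value 1, a relator is readable everywhere and labels a loop at each vertex; functionality
   excludes any other end. *)
have relator i : act_eq E (glued_vertex e) (w i) 1.
  move=> _ z [d [b [bR ->]]].
  have := actE e d b (w i) bR; rewrite valw mulg1 => /(_ (readable1 b)) fixed.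
  split=> [wz|<-//]; exact: (act_fun Efun Einj fixed wz).
have [ws vs] := valS s; have [wt vt] := valS t.
have from1 d u : val u = a d -> act E u (glue e d 1) (glue e d (sigma (a d))).
  move=> vu; have := actE e d (e d) u (eR d).
  by rewrite vu (sigma_idem (ee d)) mulsVs; apply; apply: readable_range.
pose v := wt^-1 * ws.
have vts : val v = t^-1 * s by rewrite valM.2 valV vs vt.
have idv : idempotent (val v).
  by apply: E_unitary_idem; rewrite // vts sigmaM sigmaV -st mulVg.
(* Go back along [t] in one copy to 1, which both copies share, then along [s] in the other copy. *)
have crossing : act E v (glue e true (sigma s)) (glue e false (sigma s)).
  apply/act_cat; exists (glue e true 1).
    by apply/act_inv; rewrite {1}st; apply: from1.
  have -> : glue e true 1 = glue e false 1 by rewrite /glue; case: asboolP.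
  exact: (from1 false).
have vv : act_eq E (glued_vertex e) (v * v) v.
  apply: valC; last by rewrite valM.2.
  - exact: act_eq_congruence Edom.
  - by move=> u1 u2; apply: act_eq_vagner Efun Einj _ _.
  - exact: relator.
have tgt : glued_vertex e (glue e true (sigma s)).
  by exists true, t; rewrite st; split=> //; exact: (aR true).
have /(vv _ _ tgt) := crossing.
(* Now [v] sends both copies of [sigma s] to the same one, so injectivity identifies them and
   [sigma s] is glued. *)
case/act_cat => z vz; rewrite (act_fun Efun Einj vz crossing) => vF.
have := act_injective Efun Einj crossing vF.
by rewrite /glue; case: asboolP.
Qed.

(** * Maxima of [sigma]-classes *)

Definition dominated (S : inverseMonoidType) (g : max_group_image S) (r : seq S) :=
  forall a, sigma a = g -> exists f, [/\ f \in r, sigma f = g & natural_le a f].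

Section NaturalOrder.
Variable S : inverseMonoidType.

Lemma natural_le_trans (s t u : S) : natural_le s t -> natural_le t u -> natural_le s u.
Proof.
move=> [e ee ->] [f ff ->]; exists (f * e); last by rewrite mulgA.
by rewrite /idempotent -{2}(idemC ee ff) !mulgA -(mulgA f) ee -mulgA (idemC ee ff) mulgA ff.
Qed.

(** Binary upper bounds are folded over [r], skipping its elements outside the fibre of [g]; any
    element of the fibre starts the induction. *)
Lemma special_max (g : max_group_image S) (r : seq S) :
  special S -> E_unitary S -> dominated g r ->
  exists m, sigma m = g /\ forall s, sigma s = g -> natural_le s m.
Proof.
move=> specS unitS domS.
suff [m [mg rm]] : exists m, sigma m = g /\
    forall f, f \in r -> sigma f = g -> natural_le f m.
  exists m; split=> // s /domS[f [fr fg sf]].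
  exact: natural_le_trans sf (rm f fr fg).
elim: r {domS} => [|f r [m [mg rm]]].
  by have [s sg] := sigma_surj g; exists s.
have [fg|fg] := pselect (sigma f = g); last first.
  exists m; split=> // f'; rewrite in_cons => /predU1P[->//|]; exact: rm.
have [m' [m'f fm' mm']] : exists m', [/\ sigma m' = sigma f, natural_le f m' & natural_le m m'].
  by apply: special_upper_bound; rewrite // fg mg.
exists m'; split; first by rewrite m'f.
move=> f'; rewrite in_cons => /predU1P[->//|fr fg'].
exact: natural_le_trans (rm _ fr fg') mm'.
Qed.

End NaturalOrder.

(** * Distortion and standard metrics *)

Section Distortion.
Variables (R : realType) (S : inverseMonoidType) (dS : S -> S -> \bar R)
  (dG : max_group_image S -> max_group_image S -> \bar R).
Hypotheses (hdS : standard_metric dS) (hdG : standard_metric dG).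
Local Notation G := (max_group_image S).
Import Order.TTheory Num.Theory.

(** The R-related elements [a * a^-1] and [a] map to 1 and [g], which bounds their distance
    independently of [a]; properness then gives [a = a * a^-1 * f]. *)
Lemma distortion_dominated (g : G) :
  uniformly_bounded_group_distortion dS dG -> exists r, dominated g r.
Proof.
move=> [phi phi0 phiP].
have dG0 : (0 <= fine (dG 1%g g))%R.
  by apply: fine_ge0; apply: emetric_ge0 (standard_emetric hdG) _ _.
have [F /finite_seqP[r ->] rP] := standard_proper hdS (phi0 _ dG0).
(* Properness only concerns distinct points; 1 dominates [a] when [a * a^-1 = a]. *)
exists (1 :: r) => a ag.
have aR := Rrel_range a.
have sa1 : sigma (a * a^-1) = 1 by apply: sigma_idem; apply: idem_range.
have [aa|/rP] := pselect (a * a^-1 = a).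
  exists 1; split; first exact: mem_head.
    by rewrite (sigma_idem (@idem1 S)) -sa1 aa.
  by apply/natural_leP; rewrite mulg1.
case; first by rewrite -ag -{1}sa1; apply: phiP.
move=> f fr af; exists f; split.
- by rewrite in_cons orbC fr.
- by rewrite -ag af sigmaM sa1 mul1g.
- exact/natural_leP.
Qed.

Lemma group_distance_bound (r : R) : (0 <= r)%R ->
  exists l : seq G, forall g h, (fine (dG g h) <= r)%R -> g^-1 * h \in l.
Proof.
move=> r0; have [F /finite_seqP[l ->] lP] := standard_proper hdG r0.
exists (1 :: l) => g h ghr.
have [<-|gh] := pselect (g = h); first by rewrite mulVg mem_head.
(* [fine] sends [+oo] to 0, so finiteness is needed to pass from the bound on [fine (dG g h)] to
   [dG g h]. *)
have fin : (dG g h < +oo)%E by apply/(standard_finite hdG); rewrite /Rrel !mulgV.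
have [|f fl ->] := lP g h gh.
  rewrite -[dG g h]fineK ?lee_fin// ge0_fin_numE//.
  exact: emetric_ge0 (standard_emetric hdG) _ _.
by rewrite mulKg in_cons orbC fl.
Qed.

Lemma F_inverse_distortion :
  F_inverse S -> uniformly_bounded_group_distortion dS dG.
Proof.
move=> /choice[m mP].
pose D g := dS (m g * (m g)^-1) (m g).
have dist s t : Rrel s t -> (dS s t <= D ((sigma s)^-1 * sigma t)%g)%E.
  rewrite /D; set g := (sigma s)^-1 * sigma t => st; have [mg mle] := mP g.
  have /mle/natural_leP : sigma (s^-1 * t) = g by rewrite sigmaM sigmaV.
  (* As [s] and [t] are R-related, this becomes [s^-1 * t = s^-1 * s * m g]. *)
  rewrite invgM invgK mulgA -(mulgA s^-1) -st mulgA mulVsV => sm.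
  have tE : t = s * m g.
    by rewrite -[t]mulsVs -st -mulgA sm !mulgA mulsVs.
  (* [m g] is readable at [s], its end [t] being R-related to [s]; subinvariance can then cancel [s]
     on the left. *)
  have sE : s = s * (m g * (m g)^-1).
    by apply/esym; rewrite mulgA; apply/readable_Rrel; rewrite -tE.
  by rewrite {1}sE tE; apply: standard_subinvariant.
have Dfin g : (D g <= (fine (D g))%:E)%E.
  rewrite fineK ?ge0_fin_numE//; last exact: emetric_ge0 (standard_emetric hdS) _ _.
  apply/(standard_finite hdS); exact: Rrel_range.
have bound (l : seq G) : exists2 B : R, (0 <= B)%R & forall g, g \in l -> (D g <= B%:E)%E.
  elim: l => [|g l [B B0 BP]]; first by exists 0%R.
  exists (Num.max B (fine (D g))); first by rewrite le_max B0.
  move=> h; rewrite in_cons => /predU1P[->|/BP hB].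
    by apply: le_trans (Dfin g) _; rewrite lee_fin le_max lexx orbT.
  by apply: le_trans hB _; rewrite lee_fin le_max lexx.
have /choice[phi phiP] : forall r : R, exists B : R, (0 <= B)%R /\
    forall s t, Rrel s t -> fine (dG (sigma s) (sigma t)) = r -> (dS s t <= B%:E)%E.
  (* No distance is negative, so the value 0 serves for [r] below 0. *)
  move=> r; have [r0|r0] := leP 0%R r; last first.
    exists 0%R; split=> // s t _ rE; move: r0; rewrite -rE ltNge fine_ge0//.
    exact: emetric_ge0 (standard_emetric hdG) _ _.
  have [l lP] := group_distance_bound r0; have [B B0 BP] := bound l.
  exists B; split=> // s t st rE; apply: le_trans (dist s t st) _.
  by apply/BP/lP; rewrite rE.
exists phi => [r _|s t st]; first by have [] := phiP r.
by have [_] := phiP (fine (dG (sigma s) (sigma t))); apply.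
Qed.

End Distortion.

Theorem theorem4p9 (R : realType) (S : inverseMonoidType)
    (dS : S -> S -> \bar R)
    (dG : max_group_image S -> max_group_image S -> \bar R)
    (hquasi : quasi_countable S) (hunitary : E_unitary S)
    (hspecial : special S)
    (hdS : standard_metric dS) (hdG : standard_metric dG) :
  uniformly_bounded_group_distortion dS dG <-> F_inverse S.
Proof.
split=> [dist g|]; last exact: F_inverse_distortion.
have [r domS] := distortion_dominated hdS hdG g dist.
exact: special_max domS.
Qed.
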